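(* Let $R\subset\mathbb{R}^2$ be a rectangle and let $K$ be a convex $q$-gon with $q\geq 6$. Then $K$ cannot tile $R$; that is, there do not exist an integer $N\ge 1$ and polygons $P_1,\dots,P_N$, each congruent to $K$, with pairwise disjoint interiors, such that $R=\bigcup_{j=1}^N P_j$.
   Context: Polygons (in particular rectangles) are closed polygonal regions in the plane. A polygon is called a $q$-gon if it has $q$ vertices and thus $q$ sides; for a convex polygon all interior angles at vertices are strictly less than $\pi$. Two sets $A,B\subset\mathbb{R}^2$ are congruent if $A=g(B)$, where $g$ is a composition of a rotation, possibly a reflection, and a translation. *)

(* Defs.v *)
(* MathComp / MathComp-Analysis *)
From mathcomp Require Import all_boot all_order all_algebra.
From mathcomp Require Import all_classical all_reals all_analysis.

Set Implicit Arguments.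
Unset Strict Implicit.
Unset Printing Implicit Defensive.

Import Order.TTheory GRing.Theory Num.Theory.
Import numFieldNormedType.Exports.

Local Open Scope classical_set_scope.
Local Open Scope ring_scope.

(* The topology on row vectors is the product topology, but the norm that
   MathComp-Analysis puts on them is the sup norm, so the Euclidean length has
   to be defined separately. *)
Notation plane R := 'rV[R]_2.

Section Plane.
Variable R : realType.
Implicit Types (u v w p x y : plane R) (A B K P : set (plane R)).

Definition point (a b : R) : plane R := \row_(j < 2) if j == ord0 then a else b.

Definition xcoord p : R := p ord0 ord0.
Definition ycoord p : R := p ord0 ord_max.

Definition dot u v : R := xcoord u * xcoord v + ycoord u * ycoord v.

Definition enorm u : R := Num.sqrt (dot u u).

(* The unoriented angle at y, in [0, pi]; meaningful when x, z differ from y. *)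
Definition angle x y (z : plane R) : R :=
  acos (dot (x - y) (z - y) / (enorm (x - y) * enorm (z - y))).

Definition segment x y : set (plane R) :=
  [set (1 - t) *: x + t *: y | t in `[0, 1]].

Definition boundary A : set (plane R) := closure A `\` A°.

Definition rotation (theta : R) p : plane R :=
  point (cos theta * xcoord p - sin theta * ycoord p)
        (sin theta * xcoord p + cos theta * ycoord p).

Definition reflection p : plane R := point (xcoord p) (- ycoord p).

Definition rigid_motion (theta : R) (refl : bool) (w : plane R) p : plane R :=
  (if refl then reflection (rotation theta p) else rotation theta p) + w.

Definition congruent A B : Prop :=
  exists (theta : R) (refl : bool) (w : plane R),
    A = rigid_motion theta refl w @` B.

(* Vertices are listed in cyclic order; [ordS i] and [ord_pred i] are the
   cyclic successor and predecessor of i. *)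
Definition side q (v : 'I_q -> plane R) (i : 'I_q) : set (plane R) :=
  segment (v i) (v (ordS i)).

Definition simple_closed_path q (v : 'I_q -> plane R) : Prop :=
  [/\ (3 <= q)%N,
      injective v,
      forall i, side v i `&` side v (ordS i) = [set v (ordS i)] &
      forall i j, i != j -> j != ordS i -> i != ordS j ->
        side v i `&` side v j = set0].

(* By the Jordan curve theorem, the only compact set that is the closure of its
   interior and has the path v as boundary is the closed region inside v. *)
Definition bounds q (v : 'I_q -> plane R) P : Prop :=
  [/\ simple_closed_path v, compact P, closure P° = P &
      boundary P = \bigcup_(i in [set: 'I_q]) side v i].

Definition polygon P : Prop :=
  exists (q : nat) (v : 'I_q -> plane R), bounds v P.

(* In a convex polygon the interior angle at a vertex is the unoriented angle
   between the two sides that meet there. *)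
Definition convex_qgon q K : Prop :=
  exists v : 'I_q -> plane R,
    [/\ bounds v K, convex_set K &
        forall i, angle (v (ord_pred i)) (v i) (v (ordS i)) < pi].

Definition rectangle A : Prop :=
  exists p u w : plane R,
    [/\ u != 0, w != 0, dot u w = 0 &
        A = [set p + s *: u + t *: w | s in `[0, 1] & t in `[0, 1]]].

Definition tiles K A : Prop :=
  exists (N : nat) (P : 'I_N -> set (plane R)),
    [/\ (1 <= N)%N,
        forall j, polygon (P j) /\ congruent (P j) K,
        trivIset [set: 'I_N] (fun j => (P j)°) &
        A = \bigcup_(j in [set: 'I_N]) P j].

End Plane.

(* Main.v *)
Require Import Defs.
From mathcomp Require Import all_boot all_order all_algebra.
From mathcomp Require Import all_classical all_reals all_analysis.
From mathcomp Require Import ring lra zify.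

Set Implicit Arguments.
Unset Strict Implicit.
Unset Printing Implicit Defensive.

Import Order.TTheory GRing.Theory Num.Theory.
Import numFieldNormedType.Exports.

Local Open Scope classical_set_scope.
Local Open Scope ring_scope.

(** The theorem is a count of angles.  In units of pi, the angles of a convex
    q-gon sum to q - 2, while the angles around a point that is a vertex of
    some tile sum to 2, 1 or, at a corner of the rectangle, 1/2.  When q >= 6
    the average angle is at least 2/3, but every angle is less than 1: three
    or more vertices meet where the sum is 2 and two or more where it is 1, so
    the average there is at most 2/3, and at the corners it is at most 1/2.
    Since there are corners, this is a contradiction.

    To avoid measuring angles, and angle sums of polygons, the measure of an
    angle is replaced by a test against a single line direction w.  The
    crossing number of a set P at p is the number (0, 1 or 2) of the two rays
    from p along w and -w that start by running into the interior of P; its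
    mean over w would be the angle of P at p in units of pi.  If w is parallel
    to no line through two vertices of a tile and to no side of the rectangle,
    the following hold.

    - A tile has crossing number 1 at all its vertices except the two where
      cross w is extremal (crossing_count).  This is the counterpart of the
      angle sum q - 2.
    - The crossing numbers of the tiles at p add up to the crossing number of
      the rectangle at p (sum_crossing), because each ray that stays in the
      rectangle runs into exactly one tile.
    - The crossing number of a tile at a point other than its vertices does
      not depend on w (crossing_nonvertex): the tile looks like nothing, a
      half-plane or the plane there.
    - At a vertex some direction gives crossing number 0 (vertex_blind).  This
      is where angles less than pi are used.

    The last three facts yield the bounds on the number d of vertices at a
    point p.  The crossing number of the rectangle is the same for all
    directions unless p is a corner; comparing w with a direction in which one
    of the vertices at p has crossing number 0 shows that the vertices at p
    have total crossing number c < d (vertex_crossings_lt_degree).  As c <= 2,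
    this gives 3 c <= 2 d.  At the corners, the direction w is chosen so that
    the rectangle has crossing numbers 0, 1, 0, 1, and the sum of 3 c over
    them is at least 2 less than the sum of 2 d.  Hence, with N tiles,
    3 N (q - 2) < 2 N q, which fails for q >= 6.

    The count uses only the two side directions of the rectangle, and is
    carried out for a parallelogram with vertex o and sides a and b. *)

(** * The cross product and generic directions *)

Section Vectors.
Variable R : realType.
Implicit Types (u v w d e : plane R) (s : seq (plane R)).

Definition cross u v : R := xcoord u * ycoord v - ycoord u * xcoord v.

Lemma plane_ext u v : xcoord u = xcoord v -> ycoord u = ycoord v -> u = v.
Proof.
move=> hx hy; apply/rowP => j.
have [->|j0] := eqVneq j ord0; first exact: hx.
by have -> : j = ord_max by apply/val_inj; case: j j0 => [[|[|]]].
Qed.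

Lemma crossDr u v w : cross u (v + w) = cross u v + cross u w.
Proof. by rewrite /cross /xcoord /ycoord !mxE; ring. Qed.

Lemma crossZr u a v : cross u (a *: v) = a * cross u v.
Proof. by rewrite /cross /xcoord /ycoord !mxE; ring. Qed.

Lemma crossBr u v w : cross u (v - w) = cross u v - cross u w.
Proof. by rewrite /cross /xcoord /ycoord !mxE; ring. Qed.

Lemma crossNl u v : cross (- u) v = - cross u v.
Proof. by rewrite /cross /xcoord /ycoord !mxE; ring. Qed.

Lemma crossBl u v w : cross (u - v) w = cross u w - cross v w.
Proof. by rewrite /cross /xcoord /ycoord !mxE; ring. Qed.

Lemma crossZl a u v : cross (a *: u) v = a * cross u v.
Proof. by rewrite /cross /xcoord /ycoord !mxE; ring. Qed.

Lemma crossC u v : cross u v = - cross v u.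
Proof. by rewrite /cross; ring. Qed.

Lemma crossvv u : cross u u = 0.
Proof. by rewrite /cross; ring. Qed.

Lemma cross0r u : cross u 0 = 0.
Proof. by rewrite -(scale0r u) crossZr mul0r. Qed.

Lemma cross0l u : cross 0 u = 0.
Proof. by rewrite crossC cross0r oppr0. Qed.

Lemma cross_decomp u v w : cross u v != 0 ->
  w = (cross w v / cross u v) *: u + (cross u w / cross u v) *: v.
Proof.
move=> h; apply: plane_ext; move: h; rewrite /cross /xcoord /ycoord !mxE => h;
  by field.
Qed.

Lemma dotvv_gt0 u : u != 0 -> 0 < dot u u.
Proof.
move=> u0; rewrite lt_neqAle; apply/andP; split; last first.
  by rewrite /dot addr_ge0 // -expr2 sqr_ge0.
apply: contraNneq u0 => /esym; rewrite /dot => h.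
have hx : xcoord u = 0 by nra.
have hy : ycoord u = 0 by nra.
by apply/eqP/plane_ext; rewrite ?hx ?hy /xcoord /ycoord mxE.
Qed.

Lemma cross_eq0_collinear w d : w != 0 -> cross w d = 0 -> exists a, d = a *: w.
Proof.
move=> /dotvv_gt0 w0 wd; exists (dot d w / dot w w).
have h : dot w w != 0 by rewrite gt_eqF.
apply: (scalerI h); rewrite scalerA mulrCA divff // mulr1.
move: wd; rewrite /cross => wd.
apply: plane_ext; rewrite /dot /xcoord /ycoord !mxE.
  rewrite /xcoord /ycoord in wd; apply/eqP; rewrite -subr_eq0; apply/eqP.
  set a := _ - _; have -> : a = - w ord0 ord_max * (w ord0 ord0 * d ord0 ord_max - w ord0 ord_max * d ord0 ord0) by rewrite /a; ring.
  by rewrite wd mulr0.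
rewrite /xcoord /ycoord in wd; apply/eqP; rewrite -subr_eq0; apply/eqP.
set a := _ - _; have -> : a = w ord0 ord0 * (w ord0 ord0 * d ord0 ord_max - w ord0 ord_max * d ord0 ord0) by rewrite /a; ring.
by rewrite wd mulr0.
Qed.

(** For each d in s, the vector e1 - b e2 is parallel to d for at most one b,
    so it suffices that b exceed finitely many bad values. *)
Lemma generic_direction e1 e2 s : cross e1 e2 != 0 -> 0 \notin s ->
  exists2 b : R, 0 < b & {in s, forall d, cross (e1 - b *: e2) d != 0}.
Proof.
move=> he s0; exists (1 + \sum_(d <- s) `|cross e1 d / cross e2 d|).
  by rewrite ltr_pwDl // sumr_ge0.
move=> d ds; set b := 1 + _.
rewrite crossBl crossZl.
have [h2|h2] := eqVneq (cross e2 d) 0.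
  rewrite h2 mulr0 subr0; apply: contraNneq s0 => h1.
  suff <- : d = 0 by [].
  rewrite (cross_decomp d he) (crossC d e2) h2 h1.
  by rewrite oppr0 !mul0r !scale0r addr0.
rewrite subr_eq0 -(can2_eq (mulfVK h2) (mulfK h2)).
rewrite lt_eqF // (le_lt_trans (ler_norm _)) //.
by rewrite /b (big_rem d) //= addrCA ltrDl ltr_pwDl // sumr_ge0.
Qed.

End Vectors.

(** * Crossing numbers of a convex tile *)

Section ConvexTile.
Variable R : realType.
Implicit Types (u w x y z p : plane R) (P : set (plane R)).

Lemma interior_normP P x :
  P° x <-> exists2 r : R, 0 < r & forall y, `|y - x| < r -> P y.
Proof.
split=> [/nbhs_ballP[r /= r0 h]|[r r0 h]].
  by exists r => // y yx; apply: h; rewrite -ball_normE /ball_ /= distrC.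
apply/nbhs_ballP; exists r => //= y; rewrite -ball_normE /ball_ /= => yx.
by apply: h; rewrite distrC.
Qed.

(** The homothety of centre p and ratio t maps a ball around z inside P to a
    ball inside P. *)
Lemma interior_open_segment P p z (t : R) :
  (forall x y t, 0 <= t <= 1 -> P x -> P y -> P ((1 - t) *: x + t *: y)) ->
  0 < t <= 1 -> P p -> P° z -> P° ((1 - t) *: p + t *: z).
Proof.
move=> cP /andP[t0 t1] Pp /interior_normP[r r0 Pr].
apply/interior_normP; exists (t * r); first exact: mulr_gt0.
move=> y yr; have t0' : t != 0 by rewrite gt_eqF.
have -> : y = (1 - t) *: p + t *: (z + t^-1 *: (y - ((1 - t) *: p + t *: z))).
  by rewrite scalerDr scalerA divff // scale1r [RHS]addrA addrC subrK.
apply: cP => //; first by rewrite ltW.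
apply: Pr; rewrite addrC addKr normrZ gtr0_norm ?invr_gt0 //.
by rewrite mulrC ltr_pdivrMr // mulrC.
Qed.

Definition enters P p w := P p /\ exists2 t : R, 0 < t & P° (p + t *: w).

Lemma interior_enters P p w : P° p -> enters P p w.
Proof.
move=> Pp; split; first exact: interior_subset Pp.
have /interior_normP[r r0 Pr] : P°° p by rewrite ((interior_id _).1 (open_interior P)).
have n0 : 0 < 1 + `|w| by rewrite ltr_pwDl.
exists (r / (1 + `|w|)); first exact: divr_gt0.
apply: Pr; rewrite addrC addKr normrZ gtr0_norm ?divr_gt0 //.
by rewrite mulrAC ltr_pdivrMr // ltr_pM2l // ltrDr.
Qed.

Lemma asbool_add_gt0 (B C : Prop) : B \/ C -> (0 < `[< B >] + `[< C >])%N.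
Proof. by case=> /asboolT ->; rewrite ?addn1. Qed.

Lemma asbool_add_le1 (B C : Prop) : (B -> C -> False) ->
  (`[< B >] + `[< C >] <= 1)%N.
Proof. by move=> BC; case: asboolP => hB; case: asboolP => // /(BC hB). Qed.

Lemma asbool_add2 (B C : Prop) : B -> C -> (`[< B >] + `[< C >] = 2)%N.
Proof. by move=> /asboolT -> /asboolT ->. Qed.

Lemma asbool_add0 (B C : Prop) : ~ B -> ~ C -> (`[< B >] + `[< C >] = 0)%N.
Proof. by move=> /asboolF -> /asboolF ->. Qed.

(** A discrete substitute for the angle of P at p: the number of sides of p on
    the line of direction w where that line runs into the interior of P. *)
Definition crossing P p w : nat := `[< enters P p w >] + `[< enters P p (- w) >].

(** The consequences of being a convex q-gon with vertices v on which the
    counting rests, in a form that rigid motions visibly preserve: the condition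
    on the angle at a vertex becomes the independence of the adjacent sides. *)
Record convex_tile q (v : 'I_q -> plane R) P : Prop := ConvexTile {
  tile_convex : forall x y (t : R), 0 <= t <= 1 -> P x -> P y ->
    P ((1 - t) *: x + t *: y);
  tile_solid : P° !=set0;
  tile_inj : injective v;
  tile_side : forall i, side v i `<=` P `\` P°;
  tile_boundary : P `\` P° `<=` \bigcup_(i in [set: 'I_q]) side v i;
  tile_corner : forall i,
    cross (v (ord_pred i) - v i) (v (ordS i) - v i) != 0 }.

(** All pairs of vertices are considered, and not only sides, so that the linear
    form cross w takes distinct values at the vertices. *)
Definition generic q (v : 'I_q -> plane R) w :=
  forall i j, i != j -> cross w (v i - v j) != 0.

Lemma genericN q (v : 'I_q -> plane R) w : generic v w -> generic v (- w).
Proof. by move=> gw i j ij; rewrite crossNl oppr_eq0 gw. Qed.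

Section Tile.
Variables (q : nat) (v : 'I_q -> plane R) (P : set (plane R)).
Hypothesis tP : convex_tile v P.

Lemma ordS_neq i : i != ordS i :> 'I_q.
Proof.
apply: contraNneq (tile_corner tP i) => <-.
by rewrite subrr cross0r.
Qed.

Lemma vertex_side i : side v i (v i).
Proof.
exists 0; first by rewrite /= in_itv /= lexx ler01.
by rewrite subr0 scale1r scale0r addr0.
Qed.

Lemma vertex_mem i : P (v i).
Proof. exact: (tile_side tP (vertex_side i)).1. Qed.

Lemma vertex_notin_interior i : ~ P° (v i).
Proof. exact: (tile_side tP (vertex_side i)).2. Qed.

Lemma side_direction i x y : side v i x -> side v i y ->
  exists a : R, x - y = a *: (v i - v (ordS i)).
Proof.
move=> [s _ <-] [t _ <-]; exists (t - s).
by apply: plane_ext; rewrite /xcoord /ycoord !mxE; ring.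
Qed.

(** A segment of generic direction meets each side in at most one point, so only
    finitely many of its points are on the boundary. *)
Lemma generic_enters p w (t : R) : generic v w -> P p -> 0 < t ->
  P (p + t *: w) -> enters P p w.
Proof.
move=> gw Pp t0 Pt; split=> //; apply: contrapT => nin.
(* One point more than there are sides: two of them share a side. *)
pose s (k : 'I_q.+1) : R := t / k.+1%:R.
have s0 k : 0 < s k by rewrite divr_gt0 // ltr0n.
have sinj : injective s.
  move=> k l /(mulfI (lt0r_neq0 t0)) /invr_inj /eqP.
  by rewrite eqr_nat eqSS => /eqP /val_inj.
have Ps k : exists i, side v i (p + s k *: w).
  have [|i _ h] := tile_boundary tP (t := p + s k *: w); last by exists i.
  split; last by move=> h; apply: nin; exists (s k).
  have -> : p + s k *: w
          = (1 - k.+1%:R^-1) *: p + k.+1%:R^-1 *: (p + t *: w).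
    by apply: plane_ext; rewrite /xcoord /ycoord /s !mxE; ring.
  apply: (tile_convex tP) => //.
  by rewrite invr_ge0 ler0n /= invf_le1 ?ltr0n // ler1n.
have [f hf] := choice Ps.
have /injectiveP : ~~ injectiveb f.
  apply/negP => /injectiveP /leq_card; rewrite !card_ord; lia.
apply => k l fkl; apply: contrapT => /eqP kl.
have hk := hf k; have hl := hf l; rewrite fkl in hk.
have [a ha] := side_direction hk hl.
have := gw _ _ (ordS_neq (f l)).
have skl : s k - s l != 0 by rewrite subr_eq0 (inj_eq sinj).
have : cross w ((s k - s l) *: w) = 0 by rewrite crossZr crossvv mulr0.
have -> : (s k - s l) *: w = a *: (v (f l) - v (ordS (f l))).
  by rewrite -ha opprD addrACA subrr add0r scalerBl.
rewrite crossZr => /eqP; rewrite mulf_eq0 => /orP[/eqP a0|/eqP ->]; last by rewrite eqxx.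
have /eqP : (s k - s l) *: w = 0.
  by rewrite scalerBl -[RHS](scale0r (v (f l) - v (ordS (f l)))) -a0 -ha opprD addrACA subrr add0r.
by rewrite scaler_eq0 (negbTE skl) /= => /eqP ->; rewrite cross0l eqxx.
Qed.

Lemma ratio_itv (a b c : R) : a < b <= c -> 0 < (b - a) / (c - a) <= 1.
Proof.
move=> /andP[ab bc]; have ac := lt_le_trans ab bc.
by rewrite divr_gt0 ?subr_gt0 //= ler_pdivrMr ?subr_gt0 // mul1r lerD2r.
Qed.

(** The line through m of direction w is a level line of cross w.  It meets the
    interior of P, since an open segment from x or y to any interior point lies
    in the interior and one of these segments crosses the level of m. *)
Lemma straddle_enters x y m w : P x -> P y -> P m ->
  cross w x < cross w m < cross w y -> enters P m w \/ enters P m (- w).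
Proof.
move=> Px Py Pm /andP[xm my].
have w0 : w != 0.
  by apply: contraTneq (lt_trans xm my) => ->; rewrite !cross0l ltxx.
suff [z Pz zm] : exists2 z, P° z & cross w z = cross w m.
  have [a ha] : exists a, z - m = a *: w.
    by apply: cross_eq0_collinear => //; rewrite crossBr zm subrr.
  have zE : z = m + a *: w by rewrite -ha addrC subrK.
  have [a0|a0|a0] := ltgtP a 0.
  - right; split=> //; exists (- a); first by rewrite oppr_gt0.
    by rewrite scalerN scaleNr opprK -zE.
  - by left; split=> //; exists a => //; rewrite -zE.
  - by left; apply: interior_enters; rewrite zE a0 scale0r addr0 in Pz.
have [z0 Pz0] := tile_solid tP.
have key x' : P x' -> cross w x' != cross w z0 ->
    0 < (cross w m - cross w x') / (cross w z0 - cross w x') <= 1 ->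
    exists2 z, P° z & cross w z = cross w m.
  move=> Px' ne t01.
  set t := (_ / _) in t01.
  exists ((1 - t) *: x' + t *: z0).
    exact: interior_open_segment (tile_convex tP) t01 Px' Pz0.
  by rewrite crossDr !crossZr /t; field; rewrite subr_eq0 eq_sym.
have [zm|mz|zm] := ltgtP (cross w z0) (cross w m).
- have yz := lt_trans zm my; apply: (key y) => //; first by rewrite gt_eqF.
  have := @ratio_itv (- cross w y) (- cross w m) (- cross w z0).
  rewrite lerN2 ltrN2 (ltW zm) my => /(_ isT).
  by rewrite -!opprD invrN mulrNN.
- have xz := lt_trans xm mz; apply: (key x) => //; first by rewrite lt_eqF.
  by rewrite ratio_itv // xm ltW.
- by exists z0.
Qed.

Lemma enters_both p w : enters P p w -> enters P p (- w) -> P° p.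
Proof.
move=> [Pp [s s0 Ps]] [_ [t t0 Pt]].
have st : s + t != 0 by rewrite gt_eqF // addr_gt0.
have -> : p = (1 - t / (s + t)) *: (p + t *: - w) + (t / (s + t)) *: (p + s *: w).
  by apply: plane_ext; rewrite /xcoord /ycoord !mxE; field.
apply: interior_open_segment (tile_convex tP) _ (interior_subset Pt) Ps.
by rewrite divr_gt0 ?addr_gt0 //= ler_pdivrMr ?addr_gt0 // mul1r lerDr ltW.
Qed.

Lemma crossing_vertex i w : (crossing P (v i) w <= 1)%N.
Proof.
apply: asbool_add_le1 => h1 h2.
exact: vertex_notin_interior (enters_both h1 h2).
Qed.

Lemma crossing_gt0 p w : enters P p w \/ enters P p (- w) ->
  (0 < crossing P p w)%N.
Proof. exact: asbool_add_gt0. Qed.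

(** Seen from a point in the relative interior of a side, the tile is a
    half-plane, which contains exactly one of the two rays.  It is enough that
    the ends of the side straddle the level of p for cross w. *)
Lemma crossing_nonvertex p w : generic v w -> (forall i, v i <> p) ->
  crossing P p w = (`[< P p >] + `[< P° p >])%N.
Proof.
move=> gu nv; have [ip|nip] := pselect (P° p).
  rewrite (asboolT (interior_subset ip)) (asboolT ip).
  by apply: asbool_add2; exact: interior_enters.
rewrite (asboolF nip) addn0; have [Pp|nPp] := pselect (P p); last first.
  by rewrite (asboolF nPp); apply: asbool_add0 => -[].
rewrite (asboolT Pp).
apply/eqP; rewrite eqn_leq; apply/andP; split.
  by apply: asbool_add_le1 => h1 h2; exact: nip (enters_both h1 h2).
apply: crossing_gt0.
have [i _ [t]] := tile_boundary tP (conj Pp nip).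
rewrite /= in_itv /= => /andP[t0 t1] pE.
have {}t0 : 0 < t.
  rewrite lt_neqAle t0 andbT; apply/eqP => t0'.
  by apply: (nv i); rewrite -pE -t0' subr0 scale1r scale0r addr0.
have {}t1 : t < 1.
  rewrite lt_neqAle t1 andbT; apply/eqP => t1'.
  by apply: (nv (ordS i)); rewrite -pE t1' subrr scale1r scale0r add0r.
have := gu _ _ (ordS_neq i); rewrite crossBr subr_eq0 neq_lt => /orP[] h.
  apply: (straddle_enters (vertex_mem i) (vertex_mem (ordS i)) Pp).
  by rewrite -pE crossDr !crossZr; apply/andP; split; nra.
apply: (straddle_enters (vertex_mem (ordS i)) (vertex_mem i) Pp).
by rewrite -pE crossDr !crossZr; apply/andP; split; nra.
Qed.

(** The angle sum of a convex q-gon: every vertex where cross w is neither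
    minimal nor maximal lies strictly between the levels of two others. *)
Lemma crossing_count w : (0 < q)%N -> generic v w ->
  (q <= \sum_i crossing P (v i) w + 2)%N.
Proof.
move=> q0 gw; pose i0 := Ordinal q0.
have inj i j : i != j -> cross w (v i) != cross w (v j).
  by move=> ij; rewrite -subr_eq0 -crossBr gw.
pose a := [arg min_(i < i0) cross w (v i)]%O.
pose b := [arg max_(i > i0) cross w (v i)]%O.
have ha i : i != a -> cross w (v a) < cross w (v i).
  rewrite /a; case: arg_minP => // k _ hk ik.
  by rewrite lt_neqAle inj 1?eq_sym //=; exact: hk.
have hb i : i != b -> cross w (v i) < cross w (v b).
  rewrite /b; case: arg_maxP => // k _ hk ik.
  by rewrite lt_neqAle inj //=; exact: hk.
have one (k : 'I_q) : (\sum_i (i == k) = 1)%N.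
  by rewrite (bigD1 k) //= eqxx big1 // => i /negbTE ->.
have <- : (\sum_i (crossing P (v i) w + ((i == a) + (i == b))))%N
          = (\sum_i crossing P (v i) w + 2)%N.
  by rewrite !big_split /= !one.
rewrite -[leqLHS]card_ord -sum1_card; apply: leq_sum => i _ /=.
have [_|ia] := eqVneq i a; first by rewrite !addn_gt0 /= orbT.
have [_|ib] := eqVneq i b; first by rewrite !addn_gt0 /= orbT.
rewrite /= !addn0; apply: crossing_gt0.
apply: (straddle_enters (vertex_mem a) (vertex_mem b)).
  exact: vertex_mem.
by rewrite ha // hb.
Qed.

(** A convex set lies in the cone spanned by two boundary segments p + e1 and
    p + e2 that start at a boundary point p.  Were a negative, the segment from
    p + e1 to the given interior point would cross the line p + R e2 in an
    interior point of P.  If that point is on the ray of e2, there are interior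
    points on the second boundary segment; otherwise p lies between it and
    p + e2, hence is interior. *)
Lemma corner_coef_ge0 p e1 e2 (a b : R) :
  P p -> ~ P° p -> P (p + e1) -> P (p + e2) ->
  (forall s : R, 0 < s < 1 -> ~ P° (p + s *: e2)) ->
  P° (p + a *: e1 + b *: e2) -> 0 <= a.
Proof.
move=> Pp nPp P1 P2 side2 Px; rewrite leNgt; apply/negP => a0.
have a1 : 0 < 1 - a by rewrite subr_gt0 (lt_trans a0).
have cP := tile_convex tP.
(* The crossing with the line p + R e2, at parameter 1 / (1 - a). *)
have : P° (p + (b / (1 - a)) *: e2).
  have -> : p + (b / (1 - a)) *: e2
     = (1 - (1 - a)^-1) *: (p + e1) + (1 - a)^-1 *: (p + a *: e1 + b *: e2).
    apply: plane_ext; rewrite /xcoord /ycoord !mxE; field; exact: lt0r_neq0.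
  apply: interior_open_segment => //; rewrite invr_gt0 a1 /= invf_le1 //.
  by rewrite lerDl oppr_ge0 ltW.
set c := b / _ => Pc.
have [c0|c0] := ltP 0 c.
  have c1 : 0 < 1 + c by rewrite addr_gt0.
  apply: (side2 (c / (1 + c))).
    by rewrite divr_gt0 //= ltr_pdivrMr // mul1r ltrDr.
  have -> : p + (c / (1 + c)) *: e2
     = (1 - (1 + c)^-1) *: p + (1 + c)^-1 *: (p + c *: e2).
    apply: plane_ext; rewrite /xcoord /ycoord !mxE; field; exact: lt0r_neq0.
  apply: interior_open_segment => //; rewrite invr_gt0 c1 /= invf_le1 //.
  by rewrite lerDl ltW.
have c1 : 0 < 1 - c by rewrite subr_gt0 (le_lt_trans c0).
apply: nPp.
have -> : p = (1 - (1 - c)^-1) *: (p + e2) + (1 - c)^-1 *: (p + c *: e2).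
  apply: plane_ext; rewrite /xcoord /ycoord !mxE; field; exact: lt0r_neq0.
apply: interior_open_segment => //; rewrite invr_gt0 c1 /= invf_le1 //.
by rewrite lerDl oppr_ge0.
Qed.

(** The angle at a vertex is the cone spanned by the independent vectors e1 and
    e2, and the line of direction e1 - b e2 with b > 0 meets that cone only at
    the apex.  The parameter b leaves room to avoid finitely many directions. *)
Lemma vertex_blind i (s : seq (plane R)) : 0 \notin s ->
  exists2 w, {in s, forall d, cross w d != 0} & crossing P (v i) w = 0%N.
Proof.
move=> s0.
have [b b0 hb] := generic_direction (tile_corner tP i) s0.
set e1 := v (ord_pred i) - v i in hb; set e2 := v (ordS i) - v i in hb.
have Pi := vertex_mem i; have nPi := @vertex_notin_interior i.
have P1 : P (v i + e1) by rewrite addrC subrK; exact: vertex_mem.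
have P2 : P (v i + e2) by rewrite addrC subrK; exact: vertex_mem.
have S2 (t : R) : 0 < t < 1 -> ~ P° (v i + t *: e2).
  move=> /andP[t0 t1]; apply: (tile_side tP (i := i) _).2.
  exists t; first by rewrite /= in_itv /= !ltW.
  by apply: plane_ext; rewrite /e2 /xcoord /ycoord !mxE; ring.
have S1 (t : R) : 0 < t < 1 -> ~ P° (v i + t *: e1).
  move=> /andP[t0 t1]; apply: (tile_side tP (i := ord_pred i) _).2.
  exists (1 - t); first by rewrite /= in_itv /= subr_ge0 ltW // gerBl ltW.
  by rewrite ord_predK; apply: plane_ext; rewrite /e1 /xcoord /ycoord !mxE; ring.
exists (e1 - b *: e2) => //.
apply: asbool_add0 => -[_ [t t0]].
  have -> : v i + t *: (e1 - b *: e2) = v i + (- (t * b)) *: e2 + t *: e1.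
    by apply: plane_ext; rewrite /xcoord /ycoord !mxE; ring.
  move=> /(corner_coef_ge0 Pi nPi P2 P1 S1).
  by rewrite oppr_ge0 leNgt mulr_gt0.
have -> : v i + t *: - (e1 - b *: e2) = v i + (- t) *: e1 + (t * b) *: e2.
  by apply: plane_ext; rewrite /xcoord /ycoord !mxE; ring.
move=> /(corner_coef_ge0 Pi nPi P1 P2 S2).
by rewrite oppr_ge0 leNgt t0.
Qed.

End Tile.
End ConvexTile.

(** * Convex polygons and their congruent copies are convex tiles *)

Section Congruence.
Variable R : realType.
Implicit Types (u w x y z p : plane R) (K P : set (plane R)).

Lemma le_norm_coord u : `|xcoord u| <= `|u| /\ `|ycoord u| <= `|u|.
Proof.
rewrite [`|u|]mx_normrE; split.
  exact: (le_bigmax _ (fun ij : 'I_1 * 'I_2 => `|u ij.1 ij.2|) (ord0, ord0)).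
exact: (le_bigmax _ (fun ij : 'I_1 * 'I_2 => `|u ij.1 ij.2|) (ord0, ord_max)).
Qed.

Lemma norm_le_coord u (r : R) :
  `|xcoord u| <= r -> `|ycoord u| <= r -> `|u| <= r.
Proof.
move=> hx hy; rewrite [`|u|]mx_normrE; apply: bigmax_le.
  exact: le_trans hx.
move=> [i j] _ /=; rewrite (ord1 i); have [->|j0] := eqVneq j ord0 => //.
by have -> : j = ord_max by apply/val_inj; case: j j0 => [[|[|]]].
Qed.

(** The norm is the sup norm, which rotations do not preserve; a Lipschitz bound
    is all that is needed to transport interiors. *)
Lemma norm_rotation_le (theta : R) u : `|rotation theta u| <= 2 * `|u|.
Proof.
have [hx hy] := le_norm_coord u.
have cs (a b : R) : `|a| <= `|u| -> `|b| <= `|u| ->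
    `|cos theta * a| <= `|u| /\ `|sin theta * b| <= `|u|.
  move=> ha hb; rewrite !normrM; split.
    rewrite -[leRHS]mul1r ler_pM // ler_norml; apply/andP; split.
      exact: cos_geN1.
    exact: cos_le1.
  rewrite -[leRHS]mul1r ler_pM // ler_norml; apply/andP; split.
    exact: sin_geN1.
  exact: sin_le1.
have [h1 h2] := cs _ _ hx hy; have [h3 h4] := cs _ _ hy hx.
rewrite mulr2n mulrDl mul1r.
apply: norm_le_coord; rewrite /xcoord /ycoord !mxE /=.
  by apply: le_trans (ler_normB _ _) _; rewrite lerD.
by apply: le_trans (ler_normD _ _) _; rewrite lerD.
Qed.

Lemma norm_reflection_le u : `|reflection u| <= `|u|.
Proof.
have [hx hy] := le_norm_coord u.
by apply: norm_le_coord; rewrite /xcoord /ycoord !mxE /= ?normrN.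
Qed.

Definition linear_part (theta : R) (refl : bool) p : plane R :=
  if refl then reflection (rotation theta p) else rotation theta p.

Definition inverse_part (theta : R) (refl : bool) p : plane R :=
  rotation (- theta) (if refl then reflection p else p).

Lemma rotationN_K theta : cancel (rotation theta) (rotation (- theta) : plane R -> _).
Proof.
move=> u; have := cos2Dsin2 theta; rewrite !expr2 => h.
rewrite /rotation cosN sinN.
apply: plane_ext; rewrite /xcoord /ycoord !mxE /=.
  rewrite -[RHS]mul1r -h; ring.
rewrite -[RHS]mul1r -h; ring.
Qed.

Lemma reflectionK : involutive (@reflection R).
Proof.
by move=> u; rewrite /reflection; apply: plane_ext;
  rewrite /xcoord /ycoord !mxE /= ?opprK.
Qed.

Lemma linear_partK theta refl : cancel (linear_part theta refl) (inverse_part theta refl).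
Proof.
by move=> u; rewrite /inverse_part /linear_part; case: refl;
  rewrite ?reflectionK rotationN_K.
Qed.

Lemma inverse_partK theta refl : cancel (inverse_part theta refl) (linear_part theta refl).
Proof.
have rK u : rotation theta (rotation (- theta) u) = u.
  by rewrite -{1}[theta]opprK rotationN_K.
by move=> u; rewrite /inverse_part /linear_part; case: refl;
  rewrite rK ?reflectionK.
Qed.

Lemma linear_partB theta refl x y :
  linear_part theta refl x - linear_part theta refl y = linear_part theta refl (x - y).
Proof.
case: refl; rewrite /linear_part /reflection /rotation;
  by apply: plane_ext; rewrite /xcoord /ycoord !mxE /=; ring.
Qed.

Lemma linear_part_comb theta refl (t : R) x y :
  linear_part theta refl ((1 - t) *: x + t *: y)
  = (1 - t) *: linear_part theta refl x + t *: linear_part theta refl y.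
Proof.
case: refl; rewrite /linear_part /reflection /rotation;
  by apply: plane_ext; rewrite /xcoord /ycoord !mxE /=; ring.
Qed.

Lemma inverse_partB theta refl x y :
  inverse_part theta refl x - inverse_part theta refl y = inverse_part theta refl (x - y).
Proof.
case: refl; rewrite /inverse_part /reflection /rotation;
  by apply: plane_ext; rewrite /xcoord /ycoord !mxE /=; ring.
Qed.

Lemma norm_linear_part_le theta refl u : `|linear_part theta refl u| <= 2 * `|u|.
Proof.
case: refl; last exact: norm_rotation_le.
exact: le_trans (norm_reflection_le _) (norm_rotation_le _ _).
Qed.

Lemma norm_inverse_part_le theta refl u : `|inverse_part theta refl u| <= 2 * `|u|.
Proof.
case: refl; apply: le_trans (norm_rotation_le _ _) _ => //.
by rewrite ler_pM2l // norm_reflection_le.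
Qed.

Lemma cross_linear_part theta refl u w :
  cross (linear_part theta refl u) (linear_part theta refl w)
  = (if refl then -1 else 1) * cross u w.
Proof.
have cs := cos2Dsin2 theta.
have -> : cross u w = (cos theta ^+ 2 + sin theta ^+ 2) * cross u w.
  by rewrite cs mul1r.
case: refl; rewrite /linear_part /reflection /rotation /cross /xcoord /ycoord;
  by rewrite !mxE /=; ring.
Qed.

Lemma interior_image (g h : plane R -> plane R) K x :
  cancel g h -> cancel h g ->
  (forall x y, `|g x - g y| <= 2 * `|x - y|) ->
  (forall x y, `|h x - h y| <= 2 * `|x - y|) ->
  (g @` K)° (g x) <-> K° x.
Proof.
move=> gK hK gL hL; split=> /interior_normP[r r0 Kr];
  apply/interior_normP; exists (r / 2); rewrite ?divr_gt0 // => y yr.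
  have [|z Kz gzy] := Kr (g y); last by rewrite -(can_inj gK gzy).
  by apply: le_lt_trans (gL _ _) _; rewrite mulrC -ltr_pdivlMr.
exists (h y) => //; apply: Kr; rewrite -[x]gK.
by apply: le_lt_trans (hL _ _) _; rewrite mulrC -ltr_pdivlMr.
Qed.

Lemma congruent_tile q (v : 'I_q -> plane R) K P :
  convex_tile v K -> congruent P K -> exists v', convex_tile (q := q) v' P.
Proof.
move=> tK [theta [refl [w ->]]].
set g := rigid_motion theta refl w.
pose L := linear_part theta refl.
have gE x : g x = L x + w by rewrite /g /rigid_motion /L /linear_part.
pose h y := inverse_part theta refl (y - w).
have gK : cancel g h by move=> x; rewrite /h gE addrK linear_partK.
have hK : cancel h g by move=> x; rewrite /h gE /L inverse_partK subrK.
have gB x y : g x - g y = L (x - y).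
  by rewrite !gE opprD addrACA subrr addr0 linear_partB.
have gL x y : `|g x - g y| <= 2 * `|x - y|.
  by rewrite gB norm_linear_part_le.
have hL x y : `|h x - h y| <= 2 * `|x - y|.
  rewrite inverse_partB opprB addrA subrK; exact: norm_inverse_part_le.
have gI x : (g @` K)° (g x) <-> K° x by exact: interior_image gK hK gL hL.
have gcomb (t : R) x y : g ((1 - t) *: x + t *: y) = (1 - t) *: g x + t *: g y.
  rewrite !gE /L linear_part_comb !scalerDr addrACA -scalerDl.
  by rewrite subrK scale1r.
have gside i : side (g \o v) i = g @` side v i.
  apply/seteqP; split=> [_ [t t01 <-]|_ [_ [t t01 <-] <-]].
    by exists ((1 - t) *: v i + t *: v (ordS i)); [exists t|rewrite gcomb].
  by exists t => //; rewrite gcomb.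
exists (g \o v); split.
- move=> _ _ t t01 [x Kx <-] [y Ky <-].
  by rewrite -gcomb; exists ((1 - t) *: x + t *: y) => //; exact: tile_convex tK _ _ _ t01 Kx Ky.
- by have [z Kz] := tile_solid tK; exists (g z); apply/gI.
- exact: inj_comp (can_inj gK) (tile_inj tK).
- move=> i; rewrite gside => _ [x xi <-].
  by have [Kx nKx] := tile_side tK xi; split; [exists x|move/gI].
- move=> _ [[x Kx <-] nKx].
  have [|i _ xi] := tile_boundary tK (t := x).
    by split=> // /gI.
  by exists i => //; rewrite gside; exists x.
- move=> i; rewrite /= !gB cross_linear_part mulf_neq0 ?(tile_corner tK) //.
  by case: (refl); rewrite ?oppr_eq0 oner_eq0.
Qed.

Lemma enorm_gt0 u : u != 0 -> 0 < enorm u.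
Proof. by move=> u0; rewrite sqrtr_gt0 dotvv_gt0. Qed.

(** Collinear vectors from y are opposite, with angle pi, unless they point the
    same way. *)
Lemma angle_lt_pi x y z : x != y -> z != y -> cross (x - y) (z - y) = 0 ->
  angle x y z < pi -> exists2 a : R, 0 < a & z - y = a *: (x - y).
Proof.
rewrite -![_ == y]subr_eq0 /angle => x0 z0 xz; set e := x - y in x0 xz *.
have [a ha] := cross_eq0_collinear x0 xz.
have a0 : a != 0 by apply: contraNneq z0 => a0; rewrite ha a0 scale0r.
rewrite ha; move: a0; rewrite neq_lt => /orP[a0|a0]; last by exists a.
have -> : dot e (a *: e) = - (- a * (enorm e * enorm e)).
  rewrite -expr2 sqr_sqrtr; last exact: ltW (dotvv_gt0 x0).
  by rewrite /dot /xcoord /ycoord !mxE; ring.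
have -> : enorm (a *: e) = - a * enorm e.
  rewrite /enorm -(ltr0_norm a0) -sqrtr_sqr -sqrtrM ?sqr_ge0 //.
  by congr Num.sqrt; rewrite /dot /xcoord /ycoord !mxE; ring.
have n0 := lt0r_neq0 (enorm_gt0 x0).
rewrite mulNr mulrCA divff ?acosN1 ?ltxx //.
by rewrite !mulf_neq0 // oppr_eq0 lt_eqF.
Qed.

(** The adjacent sides at a vertex are not opposite because the angle is less
    than pi, and do not point the same way because they would then overlap,
    contrary to the simplicity of the boundary path. *)
Lemma qgon_tile q K : convex_qgon q K -> exists v, convex_tile (q := q) v K.
Proof.
move=> [v [[[q3 vinj adj _] cK ciK bK] cvxK ang]].
have clK : closure K = K.
  apply/esym/closure_id; apply: compact_closed cK.
  exact: norm_hausdorff.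
rewrite /boundary clK in bK.
exists v; split.
- move=> x y t /andP[t0 t1] Kx Ky; apply/set_mem.
  have := cvxK y x (Itv01 t0 t1) (mem_set Ky) (mem_set Kx).
  by rewrite addrC.
- apply/set0P; apply/eqP => K0; move: ciK; rewrite K0 closure0 => K00.
  have i : 'I_q by exists 0%N; exact: leq_trans q3.
  have : (K `\` K°) (v i) by rewrite bK; exists i => //; exact: vertex_side.
  by rewrite -K00 => -[].
- exact: vinj.
- by move=> i x xi; rewrite bK; exists i.
- by rewrite bK.
- move=> i; have Sn (j : 'I_q) : ordS j != j.
    apply/eqP => /(congr1 val) /=; have jq := ltn_ord j.
    have [lt|ge] := ltnP j.+1 q; first by rewrite modn_small //; lia.
    have e : j.+1 = q by lia.
    by rewrite e modnn; lia.
  apply/eqP => c0.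
  have n1 : v (ord_pred i) != v i.
    by rewrite (inj_eq vinj) -[X in _ != X]ord_predK eq_sym Sn.
  have n2 : v (ordS i) != v i by rewrite (inj_eq vinj).
  have [a a0 ha] := angle_lt_pi n1 n2 c0 (ang i).
  have a1 : 0 < 1 + a by rewrite addr_gt0.
  set e := v (ord_pred i) - v i in ha.
  (* A point at distance less than both side lengths from the vertex. *)
  have : (side v (ord_pred i) `&` side v (ordS (ord_pred i))) (v i + (a / (1 + a)) *: e).
    split.
      exists (1 - a / (1 + a)).
        rewrite /= in_itv /= subr_ge0 ler_pdivrMr // mul1r lerDr ler01 /=.
        by rewrite gerBl divr_ge0 // ltW.
      rewrite ord_predK; apply: plane_ext; rewrite /e /xcoord /ycoord !mxE; ring.
    exists (1 + a)^-1.
      by rewrite /= in_itv /= invr_ge0 ltW // invf_le1 // lerDl ltW.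
    rewrite ord_predK mulrC -scalerA -ha.
    by apply: plane_ext; rewrite /xcoord /ycoord !mxE; ring.
  rewrite adj ord_predK => /= /eqP; rewrite -subr_eq0 addrC addKr scaler_eq0.
  rewrite mulf_eq0 invr_eq0 gt_eqF // gt_eqF //=.
  by rewrite subr_eq0 (negbTE n1).
Qed.

End Congruence.

(** * Crossing numbers in a tiled parallelogram *)

Section ParallelogramTiling.
Variables (R : realType) (q N : nat).
Variables (V : 'I_N -> 'I_q -> plane R) (P : 'I_N -> set (plane R)).
Variables (o a b : plane R).
Implicit Types (u w x y z p d : plane R).

Let A := \bigcup_(j in [set: 'I_N]) P j.

Hypothesis tileP : forall j, convex_tile (V j) (P j).
Hypothesis closedP : forall j, closed (P j).
Hypothesis disjointP : forall j k, (P j)° `&` (P k)° !=set0 -> j = k.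
Hypothesis ab : cross a b != 0.
Hypothesis AE : A = [set o + s *: a + t *: b | s in `[0, 1] & t in `[0, 1]].

Let acoord x : R := cross x b / cross a b.
Let bcoord x : R := cross a x / cross a b.

Lemma coord_decomp x : x = acoord x *: a + bcoord x *: b.
Proof. exact: cross_decomp. Qed.

Lemma acoordD p w (r : R) :
  acoord (p + r *: w - o) = acoord (p - o) + r * acoord w.
Proof. by rewrite /acoord /cross /xcoord /ycoord !mxE; ring. Qed.

Lemma bcoordD p w (r : R) :
  bcoord (p + r *: w - o) = bcoord (p - o) + r * bcoord w.
Proof. by rewrite /bcoord /cross /xcoord /ycoord !mxE; ring. Qed.

Definition corner (s t : R) := o + s *: a + t *: b.

Lemma corner_coord (s t : R) :
  acoord (corner s t - o) = s /\ bcoord (corner s t - o) = t.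
Proof.
have -> : corner s t - o = s *: a + t *: b.
  by rewrite /corner -(addrA o) (addrC o) addrK.
split.
  rewrite /acoord crossC crossDr !crossZr crossvv mulr0 addr0 -mulrN -crossC.
  by rewrite mulfK.
by rewrite /bcoord crossDr !crossZr crossvv mulr0 add0r mulfK.
Qed.

Lemma corner_eq p (s t : R) :
  acoord (p - o) = s -> bcoord (p - o) = t -> p = corner s t.
Proof. by move=> <- <-; rewrite /corner -addrA -coord_decomp addrC subrK. Qed.

Lemma mem_parallelogram x :
  A x <-> 0 <= acoord (x - o) <= 1 /\ 0 <= bcoord (x - o) <= 1.
Proof.
rewrite AE; split=> [[s /= s01 [t /= t01 <-]]|[ha hb]].
  by have [-> ->] := corner_coord s t; rewrite !in_itv /= in s01 t01.
exists (acoord (x - o)); first by rewrite /= in_itv.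
exists (bcoord (x - o)); first by rewrite /= in_itv.
exact/esym/corner_eq.
Qed.

Definition transverse w :=
  (forall j, generic (V j) w) /\ (cross w a != 0 /\ cross w b != 0).

Lemma transverseN w : transverse w -> transverse (- w).
Proof.
move=> [gw [wa wb]]; split; first by move=> j; exact: genericN.
by rewrite !crossNl !oppr_eq0.
Qed.

Lemma transverse_coord_neq0 w : transverse w -> acoord w != 0 /\ bcoord w != 0.
Proof.
move=> [_ [wa wb]]; split; first by rewrite mulf_neq0 // invr_neq0.
by rewrite mulf_neq0 ?invr_neq0 // crossC oppr_eq0.
Qed.

Definition directions : seq (plane R) :=
  [:: a, b & [seq V i.1 i.2.1 - V i.1 i.2.2
             | i <- enum {: 'I_N * ('I_q * 'I_q)} & i.2.1 != i.2.2]].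

Lemma directions_neq0 : 0 \notin directions.
Proof.
rewrite !inE !negb_or !(eq_sym 0); apply/and3P; split.
- by apply: contraNneq ab => ->; rewrite cross0l.
- by apply: contraNneq ab => ->; rewrite cross0r.
apply/mapP => -[[j [i k]]]; rewrite mem_filter /= => /andP[ik _] /esym /eqP.
by rewrite subr_eq0 (inj_eq (tile_inj (tileP j))) (negbTE ik).
Qed.

Lemma directions_transverse w :
  {in directions, forall d, cross w d != 0} -> transverse w.
Proof.
move=> h; split; last by split; apply: h; rewrite !inE eqxx ?orbT.
move=> j i k ik; apply: h; rewrite !inE; apply/orP; right; apply/orP; right.
by apply/mapP; exists (j, (i, k)); rewrite // mem_filter mem_enum ik.
Qed.

Definition leads_in p w := exists2 t : R, 0 < t & A (p + t *: w).

(** Two tiles that the same ray enters at p both contain the initial part of it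
    in their interiors. *)
Lemma enters_uniq j k p w : enters (P j) p w -> enters (P k) p w -> j = k.
Proof.
suff sub i (s t : R) : 0 < s <= t -> P i p -> (P i)° (p + t *: w) ->
    (P i)° (p + s *: w).
  move=> [Pj [s s0 Ps]] [Pk [t t0 Pt]]; apply: disjointP.
  exists (p + Num.min s t *: w); split.
    by apply: sub Ps => //; rewrite lt_min s0 t0 ge_min lexx.
  by apply: sub Pt => //; rewrite lt_min s0 t0 ge_min lexx orbT.
move=> /andP[s0 st] Pp Pt; have t0 := lt_le_trans s0 st.
have -> : p + s *: w = (1 - s / t) *: p + (s / t) *: (p + t *: w).
  by apply: plane_ext; rewrite /xcoord /ycoord !mxE; field; exact: lt0r_neq0.
apply: interior_open_segment (tile_convex (tileP i)) _ Pp Pt.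
by rewrite divr_gt0 //= ler_pdivrMr // mul1r.
Qed.

Lemma leads_in_between p w (s t : R) : A p -> A (p + t *: w) -> 0 <= s <= t ->
  A (p + s *: w).
Proof.
have mid (x d : R) : 0 <= s <= t -> 0 <= x <= 1 -> 0 <= x + t * d <= 1 ->
    0 <= x + s * d <= 1.
  move=> /andP[s0 st] /andP[x0 x1] /andP[y0 y1].
  by have [d0|d0] := leP 0 d; apply/andP; split; nra.
rewrite !mem_parallelogram !acoordD !bcoordD => -[ha hb] [ha' hb'] st.
by split; exact: mid.
Qed.

(** The initial part of the ray avoids every tile that it does not enter: a tile
    that misses p is at a positive distance, and a tile that contains p contains
    no further point of the ray, by generic_enters.  As there are finitely many
    tiles and they cover the ray, one of them is entered. *)
Lemma leads_in_enters p w : transverse w -> A p -> leads_in p w ->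
  exists j, enters (P j) p w.
Proof.
move=> [gw _] Ap [t t0 At]; apply: contrapT => no.
have far j : exists e : R, 0 < e /\ forall s : R, 0 < s < e -> ~ P j (p + s *: w).
  have [Pp|nPp] := pselect (P j p).
    exists 1; split=> // s /andP[s0 _] Ps; apply: no; exists j.
    exact (generic_enters (tileP j) (gw j) Pp s0 Ps).
  have : (~` P j)° p by rewrite ((interior_id _).1 (closed_openC (closedP (j:=j)))).
  move=> /interior_normP[r r0 hr].
  have n0 : 0 < 1 + `|w| by rewrite ltr_pwDl.
  exists (r / (1 + `|w|)); split; first exact: divr_gt0.
  move=> s /andP[s0 sr]; apply: hr; rewrite addrC addKr normrZ gtr0_norm //.
  move: sr; rewrite ltr_pdivlMr // => sr; apply: le_lt_trans sr.
  by rewrite ler_pM2l // lerDr.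
have [e he] := choice far.
pose m := \big[Num.min/t]_j e j.
have m0 : 0 < m by apply: lt_bigmin => // j _; exact: (he j).1.
have m2 : 0 < m / 2 by rewrite divr_gt0.
have mm : m / 2 < m by rewrite ltr_pdivrMr // ltr_pMr // ltr1n.
have : A (p + (m / 2) *: w).
  apply: leads_in_between Ap At _; rewrite ltW //=.
  by apply: le_trans (ltW mm) _; exact: bigmin_le_id.
move=> [j _]; apply: (he j).2; rewrite m2 /=.
by apply: lt_le_trans mm _; exact: bigmin_le.
Qed.

Lemma sum_enters p w : transverse w -> A p ->
  (\sum_j `[< enters (P j) p w >])%N = `[< leads_in p w >].
Proof.
move=> gw Ap; case: asboolP => [lw|nlw].
  have [j ej] := leads_in_enters gw Ap lw.
  rewrite (bigD1 j) //= asboolT // big1 // => k kj.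
  by rewrite asboolF // => ek; rewrite (enters_uniq ek ej) eqxx in kj.
rewrite big1 // => j _; rewrite asboolF // => -[_ [t t0 Pt]].
by apply: nlw; exists t => //; exists j => //; exact: interior_subset Pt.
Qed.

Definition region_crossing p w : nat := `[< leads_in p w >] + `[< leads_in p (- w) >].

Lemma sum_crossing p w : transverse w -> A p ->
  (\sum_j crossing (P j) p w)%N = region_crossing p w.
Proof.
move=> gw Ap; rewrite /region_crossing -!sum_enters //; last exact: transverseN.
by rewrite -big_split.
Qed.

Lemma unit_interval_inward (x d : R) : d != 0 -> 0 <= x <= 1 ->
  (if 0 < d then x < 1 else 0 < x) ->
  exists2 t, 0 < t & forall s, 0 <= s <= t -> 0 <= x + s * d <= 1.
Proof.
move=> d0 /andP[x0 x1]; case: ifPn => [dp hx|].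
  exists ((1 - x) / d); first by rewrite divr_gt0 // subr_gt0.
  move=> s /andP[s0]; rewrite ler_pdivlMr // => h.
  by apply/andP; split; nra.
rewrite -leNgt le_eqVlt (negbTE d0) /= => dn hx.
exists (x / - d); first by rewrite divr_gt0 // oppr_gt0.
move=> s /andP[s0]; rewrite ler_pdivlMr ?oppr_gt0 // => h.
by apply/andP; split; nra.
Qed.

(** Whether a short move along w stays within an interval of coordinates depends
    only on the sign of the coordinate of w and on the end that it faces. *)
Lemma leads_inE p w : transverse w -> A p ->
  `[< leads_in p w >] =
    (if 0 < acoord w then acoord (p - o) < 1 else 0 < acoord (p - o)) &&
    (if 0 < bcoord w then bcoord (p - o) < 1 else 0 < bcoord (p - o)).
Proof.
move=> gw Ap; have [a0 b0] := transverse_coord_neq0 gw.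
have [pa pb] := (mem_parallelogram p).1 Ap.
apply/asboolP/andP => [[t t0]|[ha hb]].
  rewrite mem_parallelogram acoordD bcoordD => -[/andP[h1 h2] /andP[h3 h4]].
  split; case: ifPn; rewrite -?leNgt ?le_eqVlt ?(negbTE a0) ?(negbTE b0) /=;
    by move=> *; nra.
have [s s0 hs] := unit_interval_inward a0 pa ha.
have [t t0 ht] := unit_interval_inward b0 pb hb.
exists (Num.min s t); first by rewrite lt_min s0.
have m0 : 0 <= Num.min s t by rewrite le_min !ltW.
rewrite mem_parallelogram acoordD bcoordD; split; first by rewrite hs // m0 ge_min lexx.
by rewrite ht // m0 ge_min lexx orbT.
Qed.

Lemma region_crossingE p w : transverse w -> A p ->
  let x := acoord (p - o) in let y := bcoord (p - o) in
  region_crossing p w =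
    (((if 0 < acoord w then x < 1 else 0 < x) &&
      (if 0 < bcoord w then y < 1 else 0 < y))%R +
     ((if 0 < acoord w then 0 < x else x < 1) &&
      (if 0 < bcoord w then 0 < y else y < 1))%R)%N.
Proof.
move=> gw Ap x y; rewrite /region_crossing !leads_inE //; last exact: transverseN.
have [a0 b0] := transverse_coord_neq0 gw.
have -> : acoord (- w) = - acoord w by rewrite /acoord crossNl mulNr.
have -> : bcoord (- w) = - bcoord w.
  by rewrite /bcoord crossC crossNl -crossC mulNr.
rewrite !oppr_gt0 -/x -/y.
by congr (_ + _ && _)%N; case: ltgtP a0 b0 => //; case: ltgtP.
Qed.

(** The region looks like the plane or a half-plane at p, according to whether
    p is an interior point or lies on an edge. *)
Lemma region_crossing_noncorner p u w : transverse u -> transverse w -> A p ->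
  p \notin [:: corner 0 0; corner 0 1; corner 1 0; corner 1 1] ->
  region_crossing p u = region_crossing p w.
Proof.
move=> gu gw Ap; rewrite !region_crossingE //.
have [/andP[x0 x1] /andP[y0 y1]] := (mem_parallelogram p).1 Ap.
rewrite !inE !negb_or => /and4P[c00 c01 c10 c11].
have [xl|xl] := ltP 0 (acoord (p - o)); have [xr|xr] := ltP (acoord (p - o)) 1;
have [yl|yl] := ltP 0 (bcoord (p - o)); have [yr|yr] := ltP (bcoord (p - o)) 1;
  try (by do !case: ifP); try (exfalso; lra);
  exfalso; move: c00 c01 c10 c11.
- by rewrite (@corner_eq p 1 1) ?eqxx //; lra.
- by rewrite (@corner_eq p 1 0) ?eqxx //; lra.
- by rewrite (@corner_eq p 0 1) ?eqxx //; lra.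
- by rewrite (@corner_eq p 0 0) ?eqxx //; lra.
Qed.

(** * Counting the vertices of the tiles *)

Definition degree p : nat := \sum_j \sum_i (V j i == p).

Definition vertex_crossings p w : nat := \sum_j \sum_i (V j i == p) * crossing (P j) p w.

Lemma vertex_cases j p :
  (exists2 i, V j i = p & (\sum_i (V j i == p))%N = 1%N) \/
  ((forall i, V j i <> p) /\ (\sum_i (V j i == p))%N = 0%N).
Proof.
have [[i e]|no] := pselect (exists i, V j i = p).
  left; exists i => //; rewrite (bigD1 i) //= e eqxx big1 // => k ki.
  by rewrite -e (inj_eq (tile_inj (tileP j))) (negbTE ki).
have no' i : V j i <> p by move=> e; apply: no; exists i.
by right; split=> //; rewrite big1 // => i _; have /eqP/negbTE -> := no' i.
Qed.

Lemma vertex_crossings_le_degree p w : (vertex_crossings p w <= degree p)%N.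
Proof.
apply: leq_sum => j _; apply: leq_sum => i _.
by case: eqP => //= <-; rewrite mul1n crossing_vertex.
Qed.

Lemma vertex_crossings_le_region p w : transverse w -> A p ->
  (vertex_crossings p w <= region_crossing p w)%N.
Proof.
move=> gw Ap; rewrite -sum_crossing //; apply: leq_sum => j _.
rewrite -big_distrl /=.
by have [[i _ ->]|[_ ->]] := vertex_cases j p; rewrite ?mul1n.
Qed.

(** At a point that is a vertex of no tile, the tile that contains it has positive
    crossing number, and so has the region. *)
Lemma degree_gt0 p w : transverse w -> A p ->
  region_crossing p w = 0%N -> (0 < degree p)%N.
Proof.
move=> gw Ap; have [j _ Pp] := Ap.
rewrite -sum_crossing // => /eqP; rewrite sum_nat_eq0 => /forallP /(_ j) /= /eqP cj.
rewrite /degree (bigD1 j) //= addn_gt0; apply/orP; left.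
have [[i _ -> //]|[nv _]] := vertex_cases j p.
by move: cj; rewrite (crossing_nonvertex (tileP j) (gw.1 j) nv) (asboolT Pp).
Qed.

(** Replace w by a direction w' in which one of the vertices at p has crossing
    number 0.  The total over all tiles and the terms of the tiles that do not
    have p as a vertex are unchanged, hence so is the total over the vertices at
    p, which for w' is at most degree p - 1. *)
Lemma vertex_crossings_lt_degree p w : transverse w -> A p -> (0 < degree p)%N ->
  (forall w', transverse w' -> region_crossing p w = region_crossing p w') ->
  (vertex_crossings p w < degree p)%N.
Proof.
move=> gw Ap; rewrite lt0n => dp same.
have [j0 [i0 e0]] : exists j i, V j i = p.
  apply: contrapT => no; move/negP: dp; apply; rewrite /degree sum_nat_eq0.
  apply/forallP => j /=; rewrite sum_nat_eq0; apply/forallP => i /=.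
  by rewrite eqb0; apply/eqP => e; apply: no; exists j, i.
have [w' /directions_transverse gw' blind] :=
  vertex_blind (tileP j0) i0 directions_neq0.
rewrite e0 in blind.
have one : (\sum_j (j == j0) = 1)%N.
  by rewrite (bigD1 j0) //= eqxx big1 // => k /negbTE ->.
(* With f the crossings of w at vertices, g and g' all crossings of w and w',
   and h the degree, the inequality below can be checked tile by tile. *)
have compare (f g g' h : 'I_N -> nat) : (\sum_j g j = \sum_j g' j)%N ->
    (forall j, f j + (g' j + (j == j0)) <= g j + h j)%N ->
    (\sum_j f j < \sum_j h j)%N.
  move=> gg' le; rewrite -(ltn_add2l (\sum_j g j)) {1}gg' -addn1 -one -!big_split.
  by apply: leq_sum => j _ /=; rewrite -addnA addnCA; exact: le.
apply: (compare _ (fun j => crossing (P j) p w) (fun j => crossing (P j) p w')).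
  exact: etrans (sum_crossing gw Ap) (etrans (same _ gw') (esym (sum_crossing gw' Ap))).
move=> j; rewrite -big_distrl /=.
have [[i e ->]|[nv ->]] := vertex_cases j p.
  rewrite mul1n leq_add2l; have [->|jj0] := eqVneq j j0; first by rewrite blind.
  by rewrite addn0 -e crossing_vertex.
have [jj0|_] := eqVneq j j0; first by case: (nv i0); rewrite jj0.
rewrite (crossing_nonvertex (tileP j) (gw.1 j) nv).
by rewrite (crossing_nonvertex (tileP j) (gw'.1 j) nv) mul0n add0n.
Qed.

Lemma sum_eq_seq (S : seq (plane R)) p (F : plane R -> nat) : uniq S -> p \in S ->
  (\sum_(x <- S) (p == x) * F x)%N = F p.
Proof.
move=> uS pS; rewrite (bigD1_seq p) //= eqxx mul1n big1 ?addn0 // => x xp.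
by rewrite eq_sym (negbTE xp) mul0n.
Qed.

Lemma sum_node_inequality (S : seq (plane R)) (t d f f' g g' : plane R -> nat) :
  (forall p, p \in S -> 3 * t p + 2 * (f p + f' p) <= 2 * d p + (g p + g' p))%N ->
  (3 * (\sum_(p <- S) t p) + 2 * (\sum_(p <- S) f p + \sum_(p <- S) f' p) <=
   2 * (\sum_(p <- S) d p) + (\sum_(p <- S) g p + \sum_(p <- S) g' p))%N.
Proof.
move=> le; rewrite -!big_split !big_distrr -!big_split /=.
by rewrite big_seq [leqRHS]big_seq; apply: leq_sum => p /le.
Qed.

Lemma small_nat_bound (t d : nat) : (t < d -> t <= 2 -> 3 * t <= 2 * d)%N.
Proof. lia. Qed.

Lemma vertex_count_absurd (n k t : nat) : (6 <= k -> n * k <= t + n * 2 ->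
  3 * t + 4 <= 2 * (n * k) + 2 -> False)%N.
Proof. nia. Qed.

(** For the direction u = a - c b with c > 0, the line through the corner o or
    o + a + b meets the parallelogram only at that corner, and the line through
    another corner enters it.  So at the first two corners no vertex is crossed
    although there is at least one vertex, and at the others 3 * 1 <= 2 * 1 + 1. *)
Lemma parallelogram_untileable : (6 <= q)%N -> False.
Proof.
move=> q6.
have [c c0 hc] := generic_direction ab directions_neq0.
have gu := directions_transverse hc; set u := a - c *: b in gu.
have au : 0 < acoord u.
  rewrite /acoord crossBl crossZl crossvv mulr0 subr0.
  by rewrite divff.
have bu : (0 < bcoord u) = false.
  rewrite /bcoord crossBr crossvv crossZr sub0r mulNr mulfK //.
  by rewrite oppr_gt0 ltNge ltW.
have Ac (s t : R) : 0 <= s <= 1 -> 0 <= t <= 1 -> A (corner s t).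
  by move=> hs ht; apply/mem_parallelogram; have [-> ->] := corner_coord s t.
have I0 : 0 <= (0 : R) <= 1 by rewrite lexx ler01.
have I1 : 0 <= (1 : R) <= 1 by rewrite lexx ler01.
have ex (s t : R) (hs : 0 <= s <= 1) (ht : 0 <= t <= 1) := region_crossingE gu (Ac s t hs ht).
have e00 : region_crossing (corner 0 0) u = 0%N.
  by rewrite ex //; have [-> ->] := corner_coord 0 0; rewrite au bu ltxx andbF.
have e11 : region_crossing (corner 1 1) u = 0%N.
  by rewrite ex //; have [-> ->] := corner_coord 1 1; rewrite au bu ltxx andbF.
have e01 : region_crossing (corner 0 1) u = 1%N.
  by rewrite ex //; have [-> ->] := corner_coord 0 1; rewrite au bu ltxx ltr01.
have e10 : region_crossing (corner 1 0) u = 1%N.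
  by rewrite ex //; have [-> ->] := corner_coord 1 0; rewrite au bu ltxx ltr01.
have corner_eqE s t s' t' :
    (corner s t == corner s' t') = (s == s') && (t == t').
  apply/eqP/andP => [e|[/eqP -> /eqP ->] //].
  have [] := corner_coord s t; have [] := corner_coord s' t'.
  by rewrite e => -> -> -> ->.
have node p : A p ->
  (3 * vertex_crossings p u + 2 * ((corner 0 0 == p) + (corner 1 1 == p))
   <= 2 * degree p + ((corner 0 1 == p) + (corner 1 0 == p)))%N.
  move=> Ap.
  have te := vertex_crossings_le_region gu Ap; have td := vertex_crossings_le_degree p u.
  have [pc|pnc] := boolP (p \in [:: corner 0 0; corner 0 1; corner 1 0; corner 1 1]).
    move: pc; rewrite !inE => /or4P[] /eqP e; rewrite {}e in te td Ap *;
      rewrite !corner_eqE !eqxx ?(eq_sym 0 1) ?oner_eq0 /=.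
    - by have := degree_gt0 gu Ap e00; rewrite e00 in te; lia.
    - by rewrite e01 in te; lia.
    - by rewrite e10 in te; lia.
    - by have := degree_gt0 gu Ap e11; rewrite e11 in te; lia.
  have nc : ((corner 0 0 == p) + (corner 1 1 == p) = 0)%N.
    by move: pnc; rewrite !inE !negb_or !(eq_sym p) => /and4P[/negbTE-> _ _ /negbTE->].
  rewrite nc muln0 addn0; apply: leq_trans (leq_addr _ _).
  have [d0|dp] := posnP (degree p).
    by move: td; rewrite d0 leqn0 => /eqP ->.
  have lt := vertex_crossings_lt_degree gu Ap dp (fun w' gw' => region_crossing_noncorner gu gw' Ap pnc).
  have e2 : (region_crossing p u <= 2)%N by rewrite /region_crossing; do 2 case: `[< _ >].
  exact: small_nat_bound lt (leq_trans te e2).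
pose S := undup ([:: corner 0 0; corner 0 1; corner 1 0; corner 1 1]
                 ++ [seq V i.1 i.2 | i <- enum {: 'I_N * 'I_q}]).
have uS : uniq S by exact: undup_uniq.
have VS j i : V j i \in S.
  rewrite mem_undup mem_cat; apply/orP; right; apply/mapP.
  by exists (j, i) => //; rewrite mem_enum.
have AS p : p \in S -> A p.
  rewrite mem_undup mem_cat => /orP[|/mapP[[j i] _ ->]].
    by rewrite !inE => /or4P[] /eqP ->; exact: Ac.
  by exists j => //; exact: vertex_mem (tileP j) i.
have cS s t : corner s t \in [:: corner 0 0; corner 0 1; corner 1 0; corner 1 1] ->
    (\sum_(p <- S) (corner s t == p))%N = 1%N.
  move=> h; rewrite -[RHS](@sum_eq_seq S (corner s t) (fun=> 1%N)) //.
    by apply: eq_bigr => p _; rewrite muln1.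
  by rewrite mem_undup mem_cat h.
have total : (3 * (\sum_(p <- S) vertex_crossings p u) + 4
           <= 2 * (\sum_(p <- S) degree p) + 2)%N.
  have := sum_node_inequality (fun p pS => node p (AS p pS)).
  by rewrite !cS // !inE eqxx ?orbT.
have sumd : (\sum_(p <- S) degree p = N * q)%N.
  rewrite exchange_big /= -[N in RHS]card_ord -sum_nat_const.
  apply: eq_bigr => j _; rewrite exchange_big /= -[RHS]card_ord -sum1_card.
  apply: eq_bigr => i _; rewrite -[RHS](@sum_eq_seq S (V j i) (fun=> 1%N)) //.
  by apply: eq_bigr => p _; rewrite muln1.
have sumt : (N * q <= \sum_(p <- S) vertex_crossings p u + N * 2)%N.
  rewrite exchange_big /= -[N in leqLHS]card_ord -[N in (N * 2)%N]card_ord.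
  rewrite -!sum_nat_const -big_split /=; apply: leq_sum => j _.
  rewrite exchange_big /=.
  under eq_bigr => i _ do rewrite (@sum_eq_seq S (V j i) (fun p => crossing (P j) p u)) //.
  exact: (crossing_count (tileP j) (ltn_trans _ q6) (gu.1 j)).
by rewrite sumd in total; exact: vertex_count_absurd q6 sumt total.
Qed.

End ParallelogramTiling.

Theorem theorem1p1 (R : realType) (q : nat) (A K : set 'rV[R]_2)
    (hA : rectangle A) (hq : (6 <= q)%N) (hK : convex_qgon q K) :
  ~ tiles K A.
Proof.
case: hA => o [a [b [a0 b0 ab0 AE]]] [N [P [_ hP dP AP]]].
have [v tK] := qgon_tile hK.
have [V tP] := choice (fun j => congruent_tile tK (hP j).2).
have cP j : closed (P j).
  have [n [v' [_ cPj _ _]]] := (hP j).1.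
  by apply: compact_closed cPj; exact: norm_hausdorff.
have ab : cross a b != 0.
  apply: contraNneq b0 => c0; have [k bE] := cross_eq0_collinear a0 c0.
  have : k * dot a a = 0.
    by rewrite -ab0 bE /dot /xcoord /ycoord !mxE; ring.
  by move/eqP; rewrite mulf_eq0 (gt_eqF (dotvv_gt0 a0)) orbF bE => /eqP ->; rewrite scale0r.
apply: (@parallelogram_untileable R q N V P o a b) => //.
- by move=> j k; apply: dP.
- by rewrite -AP.
Qed.
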